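(* Let $\Phi=\{\Phi_j\}_{j=1}^J$ be a self-affine system on $\mathbb{R}^d$ with attractor $F$ and convex hull $C=[F]$, $\dim C=d$, satisfying the tileset condition and the nontriviality condition, and let $\{G_q\}_{q=1}^Q$ be its generators. Then the collection $\mathcal{T}=\{R_n\}_{n=1}^\infty=\{\Phi_w(G_q): w\in W,\ q=1,\dots,Q\}$ is a tiling of $C\setminus F$ by open sets, and $$C=\overline{\bigcup_n R_n}=\overline{\bigcup_{w\in W,\,q}\Phi_w(G_q)}.$$
   Context: A self-affine system on $\mathbb{R}^d$ is a finite family $\Phi=\{\Phi_j\}_{j=1}^J$, $2\le J<\infty$, of invertible affine maps $\Phi_j:\mathbb{R}^d\to\mathbb{R}^d$, each of which is a contraction for the Euclidean norm. Its action on sets is $\Phi(A):=\bigcup_{j=1}^J\Phi_j(A)$ for $A\subseteq\mathbb{R}^d$. The attractor $F$ is the unique nonempty compact set with $F=\Phi(F)$. $C:=[F]$ is the convex hull of $F$; $\dim C=d$ means the smallest affine subspace containing $C$ is $\mathbb{R}^d$. Tileset condition: $\operatorname{int}\Phi_j(C)\cap\operatorname{int}\Phi_\ell(C)=\emptyset$ for all $j\ne\ell$. Nontriviality condition: $\operatorname{int}C\not\subseteq\Phi(C)$. The generators $G_1,\dots,G_Q$ are the connected components of the open set $\operatorname{int}(C\setminus\Phi(C))$; their number $Q$ is finite or countably infinite ($Q=\infty$ is not excluded). $W:=\bigcup_{k\ge0}\{1,\dots,J\}^k$ is the set of finite words, including the empty word, and for $w=w_1\cdots w_k$, $\Phi_w:=\Phi_{w_1}\circ\cdots\circ\Phi_{w_k}$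 (the identity for the empty word). The sets $\Phi_w(G_q)$ are the tiles, and $\{R_n\}_{n=1}^\infty$ is an enumeration of them. A tiling of a set $A\subseteq\mathbb{R}^d$ by open sets is a collection of nonempty connected open sets $\{A_n\}_{n=1}^\infty$ such that (i) $\overline{A}=\overline{\bigcup_{n=1}^\infty A_n}$ and (ii) $A_n\cap A_m=\emptyset$ for $n\ne m$. Interior and closure are taken in $\mathbb{R}^d$. *)

(* Defs.v *)
From HB Require Import structures.
From mathcomp Require Export all_boot all_order all_algebra.
From mathcomp Require Export all_classical all_reals all_analysis.

Set Implicit Arguments.
Unset Strict Implicit.
Unset Printing Implicit Defensive.

Import Order.TTheory GRing.Theory Num.Theory.
Import numFieldNormedType.Exports.

Local Open Scope classical_set_scope.
Local Open Scope ring_scope.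

(* The ambient space R^d is 'cV[R]_d. The norm `|x| of MathComp-Analysis on
   matrices is the sup norm, so the Euclidean norm is defined separately; both
   induce the topology used for interior, closure, compactness, connectedness. *)

Definition enorm (R : realType) (d : nat) (x : 'cV[R]_d) : R :=
  Num.sqrt (\sum_(i < d) x i 0 ^+ 2).

Definition invertible_affine (R : realType) (d : nat)
    (f : 'cV[R]_d -> 'cV[R]_d) : Prop :=
  exists (A : 'M[R]_d) (b : 'cV[R]_d),
    A \in unitmx /\ forall x, f x = A *m x + b.

Definition euclidean_contraction (R : realType) (d : nat)
    (f : 'cV[R]_d -> 'cV[R]_d) : Prop :=
  exists c : R, [/\ 0 <= c, c < 1 &
    forall x y, enorm (f x - f y) <= c * enorm (x - y)].

Definition self_affine_system (R : realType) (d J : nat)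
    (Phi : 'I_J -> 'cV[R]_d -> 'cV[R]_d) : Prop :=
  (2 <= J)%N /\
  forall j, invertible_affine (Phi j) /\ euclidean_contraction (Phi j).

Definition ifs_action (R : realType) (d J : nat)
    (Phi : 'I_J -> 'cV[R]_d -> 'cV[R]_d) (A : set 'cV[R]_d) : set 'cV[R]_d :=
  \bigcup_j (Phi j @` A).

(* For a self-affine system such an F exists and is unique (Hutchinson). *)
Definition is_attractor (R : realType) (d J : nat)
    (Phi : 'I_J -> 'cV[R]_d -> 'cV[R]_d) (F : set 'cV[R]_d) : Prop :=
  [/\ F !=set0, compact F & F = ifs_action Phi F].

Definition convex_hull (R : realType) (d : nat) (A : set 'cV[R]_d) :
    set 'cV[R]_d :=
  smallest (fun B : set 'cV[R]_d => convex_set B) A.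

Definition affine_subspace (R : realType) (d : nat) (A : set 'cV[R]_d) : Prop :=
  forall (x y : 'cV[R]_d) (t : R), A x -> A y -> A (t *: x + (1 - t) *: y).

Definition affine_hull (R : realType) (d : nat) (A : set 'cV[R]_d) :
    set 'cV[R]_d :=
  smallest (@affine_subspace R d) A.

Definition tileset_condition (R : realType) (d J : nat)
    (Phi : 'I_J -> 'cV[R]_d -> 'cV[R]_d) (C : set 'cV[R]_d) : Prop :=
  forall j l : 'I_J, j <> l ->
    interior (Phi j @` C) `&` interior (Phi l @` C) = set0.

Definition nontriviality_condition (R : realType) (d J : nat)
    (Phi : 'I_J -> 'cV[R]_d -> 'cV[R]_d) (C : set 'cV[R]_d) : Prop :=
  ~ (interior C `<=` ifs_action Phi C).

Definition generators (R : realType) (d J : nat)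
    (Phi : 'I_J -> 'cV[R]_d -> 'cV[R]_d) (C : set 'cV[R]_d) :
    set (set 'cV[R]_d) :=
  let U := interior (C `\` ifs_action Phi C) in
  [set connected_component U x | x in U].

(* Phi_w = Phi_{w_1} o ... o Phi_{w_k}, words being sequences over 'I_J *)
Definition word_map (R : realType) (d J : nat)
    (Phi : 'I_J -> 'cV[R]_d -> 'cV[R]_d) (w : seq 'I_J) :
    'cV[R]_d -> 'cV[R]_d :=
  foldr (fun j f => Phi j \o f) id w.

(* The tiles are indexed by the pairs (w, G) with w a word and G a generator;
   a generator plays the role of its own index q. *)
Definition tile (R : realType) (d J : nat)
    (Phi : 'I_J -> 'cV[R]_d -> 'cV[R]_d) (p : seq 'I_J * set 'cV[R]_d) :
    set 'cV[R]_d :=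
  word_map Phi p.1 @` p.2.

Definition tile_enumeration (R : realType) (d J : nat)
    (Phi : 'I_J -> 'cV[R]_d -> 'cV[R]_d) (C : set 'cV[R]_d)
    (e : nat -> seq 'I_J * set 'cV[R]_d) : Prop :=
  set_bij [set: nat] ([set: seq 'I_J] `*` generators Phi C) e.

Definition open_tiling (R : realType) (d : nat) (A : set 'cV[R]_d)
    (T : nat -> set 'cV[R]_d) : Prop :=
  [/\ forall n, [/\ T n !=set0, connected (T n) & open (T n)],
      closure A = closure (\bigcup_n T n) &
      forall n m, n <> m -> T n `&` T m = set0].

(* Main.v *)
Require Import Defs.
Import Order.TTheory GRing.Theory Num.Theory.
Import numFieldNormedType.Exports.
Local Open Scope classical_set_scope.
Local Open Scope ring_scope.

(** Why the theorem holds. Write [U] for the open set int(C \ Phi(C)), whose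
    components are the generators; the tiles with word [w] make up [Phi_w(U)].

    Geometry of [C]. The hull [C] of the compact set [F] is compact, because by
    [caratheodory] it is the image of a compact set of weights and points, of
    fixed number [d + 1], under a continuous map. Each [Phi_j] maps [C] into [C]
    since it maps [F] into [F]. As [Phi(C)] is closed, [U] is int(C) minus
    [Phi(C)], so nontriviality says precisely that [U] is nonempty; in
    particular [C] is a convex set with interior points, hence it is contained
    in the closure of its interior ([convex_closure_interior]).

    Disjointness. The maps are injective, so a common prefix of two words [w] and
    [v] can be removed. If the words then start with different letters [j] and
    [l], the open sets [Phi_w(U)] and [Phi_v(U)] lie in the interiors of
    [Phi_j(C)] and [Phi_l(C)], which the tileset condition separates. If one of
    them is exhausted first, one side is [U] and the other a subset of [Phi(C)]
    ([word_image_gap_inj]). For equal words the generators, being components, are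
    disjoint. The same descent along a word shows that no tile meets [F], since
    [F = Phi(F)] is contained in [Phi(C)] ([word_image_gap_attractor]).

    Density. A point of [C] outside [Phi(C)] is a limit of points of [U], because
    it is a limit of interior points of [C] and [Phi(C)] is closed. Hence a point
    of [C] that is not a limit of tiles lies in some [Phi_w(C)] with [w] as long
    as desired ([hull_cover]); but that set has a small diameter and contains the
    nonempty set [Phi_w(U)], so the point is a limit of tiles after all
    ([hull_closure_word_images]). Since the tiles lie in [C \ F], the closures of
    the union of the tiles, of [C \ F] and of [C] agree.

    Enumeration. Disjoint nonempty open sets contain different rational points,
    so there are countably many generators; together with the infinitely many
    words they index a countably infinite family. *)

Set Implicit Arguments.
Unset Strict Implicit.
Unset Printing Implicit Defensive.

(** * Convex hulls and Caratheodory's theorem *)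

(** The interval-valued weights of the convex spaces are awkward to compute
    with; real weights with explicit bounds are used from here on. *)
Lemma convex_setP (R : realType) (V : lmodType R) (A : set V) :
  convex_set (A : set (convex_lmodType V)) <->
  forall x y (t : R), 0 <= t -> t <= 1 -> A x -> A y -> A (t *: x + (1 - t) *: y).
Proof.
split=> [cA x y t t0 t1 Ax Ay|cA x y t xA yA].
  have t01 : Itv.spec (@Itv.num_sem R) (Itv.Real `[0%Z, 1%Z]) t.
    by rewrite /= /Itv.num_sem/= in_itv/= t0 t1 realE t0.
  have := cA x y (Itv.mk t01) (mem_set Ax) (mem_set Ay).
  by rewrite inE.
by rewrite inE; apply: cA => //; rewrite ?ge0 ?le1//; exact/set_mem.
Qed.

Lemma convex_hull_convex (R : realType) (d : nat) (A : set 'cV[R]_d) :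
  convex_set (convex_hull A : set (convex_lmodType 'cV[R]_d)).
Proof.
apply/convex_setP => x y t t0 t1 hx hy B [cB AB].
by move/convex_setP : (cB); apply => //; [exact: hx|exact: hy].
Qed.

(** The points [p i] may coincide and the weights may vanish, so these sets
    increase with [n]. *)
Definition convex_combinations (R : realType) (d : nat) (A : set 'cV[R]_d)
    (n : nat) : set 'cV[R]_d :=
  [set x | exists (p : 'I_n -> 'cV[R]_d) (w : 'I_n -> R),
    [/\ forall i, A (p i), forall i, 0 <= w i, \sum_i w i = 1 &
        x = \sum_i w i *: p i]].

(** By induction on the number of points: the last [n] points are grouped into
    one, after dividing their weights by the total [1 - w ord0]. *)
Lemma convex_set_combinations (R : realType) (d : nat) (B A : set 'cV[R]_d) n :
  convex_set (B : set (convex_lmodType 'cV[R]_d)) -> A `<=` B ->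
  convex_combinations A n `<=` B.
Proof.
move=> /convex_setP cB AB.
elim: n => [|n IHn] x [p [w [Ap w0 w1 ->]]].
  by move: w1; rewrite big_ord0 => /eqP; rewrite eq_sym oner_eq0.
move: w1; rewrite !big_ord_recl => w1.
have w0le : w ord0 <= 1 by rewrite -w1 lerDl; apply: sumr_ge0.
(* If the first weight is 1, all the others vanish and no division is needed. *)
have [w01|w01] := eqVneq (w ord0) 1.
  have /psumr_eq0P wl0 : \sum_(i < n) w (lift ord0 i) = 0.
    by move: w1; rewrite w01 => /eqP; rewrite -subr_eq0 addrC addKr => /eqP.
  rewrite big1 ?addr0 ?w01 ?scale1r; first exact: AB.
  by move=> i _; rewrite wl0 ?scale0r.
have w0lt : 0 < 1 - w ord0 by rewrite subr_gt0 lt_neqAle w01.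
rewrite -[X in _ + X](@scalerKV _ _ (1 - w ord0)) ?gt_eqF//.
apply: cB => //; first exact: AB.
apply: IHn; exists (p \o lift ord0), (fun i => (1 - w ord0)^-1 * w (lift ord0 i)).
split=> [i|i||] /=; first exact: Ap.
- by rewrite mulr_ge0// invr_ge0 ltW.
- rewrite -mulr_sumr -[X in _ * X](addKr (w ord0)) w1 [- _ + _]addrC.
  by rewrite mulVf ?gt_eqF.
- by rewrite scaler_sumr; apply: eq_bigr => i _; rewrite scalerA.
Qed.

Lemma convex_combinations_convex (R : realType) (d : nat) (A : set 'cV[R]_d)
    x y (t : R) n m : 0 <= t -> t <= 1 ->
  convex_combinations A n x -> convex_combinations A m y ->
  convex_combinations A (n + m) (t *: x + (1 - t) *: y).
Proof.
move=> t0 t1 [p [w [Ap w0 w1 ->]]] [q [v [Aq v0 v1 ->]]].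
exists (fun i : 'I_(n + m) => match fintype.split i with inl j => p j | inr j => q j end).
exists (fun i : 'I_(n + m) =>
  match fintype.split i with inl j => t * w j | inr j => (1 - t) * v j end).
split=> [i|i||].
- by case: fintype.split.
- by case: fintype.split => j; rewrite mulr_ge0 ?subr_ge0.
- rewrite big_split_ord/=.
  under eq_bigr do rewrite (unsplitK (inl _)).
  under [X in _ + X]eq_bigr do rewrite (unsplitK (inr _)).
  by rewrite -!mulr_sumr w1 v1 !mulr1 addrC subrK.
- rewrite big_split_ord/= !scaler_sumr; congr (_ + _); apply: eq_bigr => i _.
    by rewrite (unsplitK (inl _)) scalerA.
  by rewrite (unsplitK (inr _)) scalerA.
Qed.

Lemma convex_hull_combinations (R : realType) (d : nat) (A : set 'cV[R]_d) :
  convex_hull A = \bigcup_n convex_combinations A n.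
Proof.
apply/seteqP; split.
  apply: smallest_sub.
    apply/convex_setP => x y t t0 t1 [n _ nx] [m _ my].
    by exists (n + m)%N => //; exact: convex_combinations_convex.
  move=> x Ax; exists 1%N => //; exists (fun=> x), (fun=> 1).
  by rewrite !big_ord1 scale1r; split.
move=> x [n _]; apply: convex_set_combinations; first exact: convex_hull_convex.
exact: sub_gen_smallest.
Qed.

(** Padding: the point of index 0 is repeated with weight 0. *)
Lemma subset_convex_combinations (R : realType) (d : nat) (A : set 'cV[R]_d) n m :
  (n <= m)%N -> convex_combinations A n `<=` convex_combinations A m.
Proof.
move=> /subnK <-; elim: (m - n)%N => [//|k IHk] x /IHk {IHk}.
rewrite addSn; move: (k + n)%N => {m k}n [p [w [Ap w0 w1 ->]]].
case: n p w Ap w0 w1 => [|n] p w Ap w0 w1.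
  by move: w1; rewrite big_ord0 => /eqP; rewrite eq_sym oner_eq0.
exists (fun i => if unlift ord0 i is Some j then p j else p ord0).
exists (fun i => if unlift ord0 i is Some j then w j else 0).
split=> [i|i||]; try by case: unlift.
- rewrite big_ord_recl unlift_none add0r -w1.
  by apply: eq_bigr => i _; rewrite liftK.
- rewrite [RHS]big_ord_recl unlift_none scale0r add0r.
  by apply: eq_bigr => i _; rewrite liftK.
Qed.

(** Appending a coordinate 1 to each of the [n] points gives [n] row vectors of
    length [d + 1 < n], which are linearly dependent; the last coordinate makes
    the coefficients sum to 0. *)
Lemma affine_dependence (R : realType) (d n : nat) (p : 'I_n -> 'cV[R]_d) :
  (d.+1 < n)%N -> exists u : 'I_n -> R,
    [/\ exists i, 0 < u i, \sum_i u i = 0 & \sum_i u i *: p i = 0].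
Proof.
move=> dn; pose M : 'M[R]_(n, d + 1) := \matrix_i row_mx (p i)^T (1%:M).
have : kermx M != 0.
  rewrite kermx_eq0 /row_free; apply: contraTneq dn => rM.
  by rewrite -leqNgt -rM (leq_trans (rank_leq_col M))// addn1.
case/rowV0Pn => v /sub_kermxP vM v0.
have vE : \sum_i v 0 i = 0 /\ \sum_i v 0 i *: p i = 0.
  have : \sum_i v 0 i *: row_mx (p i)^T (1%:M) = 0 :> 'rV_(d + 1).
    rewrite -[RHS]vM mulmx_sum_row.
    by under [RHS]eq_bigr do rewrite rowK.
  move=> /[dup] /(congr1 rsubmx) + /(congr1 lsubmx).
  rewrite !linear_sum/= !raddf0 => h1 h2; split.
    move/matrixP/(_ 0 0) : h1; rewrite mxE summxE => h; rewrite -[RHS]h.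
    apply: eq_bigr => i _.
    by rewrite linearZ/= row_mxKr !mxE/= mulr1.
  move/(congr1 trmx) : h2; rewrite linear_sum/= trmx0 => h; rewrite -[RHS]h.
  apply: eq_bigr => i _.
  by rewrite linearZ/= row_mxKl linearZ/= trmxK.
case: vE => vs vp.
have [i vi] : exists i, v 0 i != 0.
  apply/existsP; apply: contraNT v0 => /existsPn h.
  by apply/eqP/rowP => i; rewrite mxE; apply/eqP; rewrite -[_ == _]negbK h.
have [[j vj]|nv] := pselect (exists j, 0 < v 0 j).
  by exists (v 0); split => //; exists j.
(* Coefficients without a positive entry are replaced by their opposites. *)
exists (fun i => - v 0 i); split.
- exists i; rewrite oppr_gt0 lt_neqAle vi/= leNgt; apply/negP => vi0; apply: nv.
  by exists i.
- by rewrite sumrN vs oppr0.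
- by under eq_bigr do rewrite scaleNr; rewrite sumrN vp oppr0.
Qed.

(** Moving the weights along an affine dependence [u] changes neither their sum
    nor the combination. The least ratio [w i / u i] over the positive [u i] is
    the largest step that keeps all the weights nonnegative, and it makes one of
    them vanish. *)
Lemma convex_combinations_drop (R : realType) (d : nat) (A : set 'cV[R]_d) n :
  (d.+1 <= n)%N -> convex_combinations A n.+1 `<=` convex_combinations A n.
Proof.
move=> dn x [p [w [Ap w0 w1 xE]]].
have [u [[i1 ui1] us up]] := affine_dependence p dn.
case: (@arg_minP _ _ _ i1 (fun i => 0 < u i) (fun i => w i / u i) ui1) => i ui imin.
pose t := w i / u i.
have t0 : 0 <= t by rewrite divr_ge0// ltW.
pose v j := w j - t * u j.
have vi : v i = 0 by rewrite /v /t mulfVK ?subrr// gt_eqF.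
have v0 j : 0 <= v j.
  rewrite subr_ge0; have [uj|uj] := ltP 0 (u j).
    by rewrite -ler_pdivlMr//; exact: imin.
  by rewrite (le_trans _ (w0 j))// mulr_ge0_le0.
have vs : \sum_j v j = 1 by rewrite sumrB w1 -mulr_sumr us mulr0 subr0.
have vp : \sum_j v j *: p j = x.
  under eq_bigr do rewrite scalerBl -scalerA.
  by rewrite sumrB -scaler_sumr up scaler0 subr0.
exists (p \o lift i), (v \o lift i); split=> //=.
- by rewrite -vs (bigD1_ord i)//= vi add0r.
- by rewrite -vp (bigD1_ord i)//= vi scale0r add0r.
Qed.

Theorem caratheodory (R : realType) (d : nat) (A : set 'cV[R]_d) :
  convex_hull A = convex_combinations A d.+1.
Proof.
rewrite convex_hull_combinations; apply/seteqP; split; last first.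
  by move=> x Ax; exists d.+1.
move=> x [n _]; have [nd|dn] := leqP n d.+1.
  exact: subset_convex_combinations.
rewrite -(subnK (ltnW dn)); elim: (n - d.+1)%N => [//|k IHk] Ax; apply: IHk.
by apply: convex_combinations_drop => //; rewrite leq_addl.
Qed.

(** * Compactness of convex hulls *)

(** Stated for entries in any topological space, as it is applied to rows whose
    entries are themselves vectors. *)
Lemma ptmx_coord_continuous (T : ptopologicalType) (n : nat) (i : 'I_n) :
  continuous (fun v : 'rV[T]_n => v 0 i).
Proof.
move=> v B vB; exists (fun _ j => if j == i then B else setT).
  by move=> k j; case: eqP => [->|_]; [rewrite ord1|exact: filterT].
by move=> u /(_ 0 i); rewrite eqxx.
Qed.

Lemma continuous_sum (K : numFieldType) (V : normedModType K) (T : topologicalType)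
    (n : nat) (f : 'I_n -> T -> V) :
  (forall i, continuous (f i)) -> continuous (fun x => \sum_i f i x).
Proof. by move=> cf; apply: continuous_big => //; exact: add_continuous. Qed.

(** The continuous image of the product of the standard simplex, which is closed
    in a cube, and of [n] copies of [A]. *)
Lemma convex_combinations_compact (R : realType) (d n : nat) (A : set 'cV[R]_d) :
  compact A -> compact (convex_combinations A n).
Proof.
move=> cA.
pose An := [set v : 'rV['cV[R]_d]_n | forall i, A (v 0 i)].
pose I := [set w : 'rV[R]_n | forall i, `[0, 1]%classic (w 0 i)].
pose D := I `&` [set w | \sum_i w 0 i = 1].
have cI : compact I.
  exact: (@rV_compact R n (fun=> `[0, 1]%classic) (fun=> @segment_compact R 0 1)).
have cD : compact D.
  apply: (@subclosed_compact _ _ I) => //; last by move=> w [].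
    apply: closedI.
      by apply: compact_closed => //; exact: norm_hausdorff.
    apply: (@closed_comp _ _ (fun w : 'rV[R]_n => \sum_i w 0 i) [set 1]).
      move=> w _; apply: (@continuous_sum R R^o) => i.
      exact: coord_continuous.
    exact: closed_eq.
have cAn : compact An by exact: (@rV_compact _ n (fun=> A) (fun=> cA)).
pose f (wv : 'rV[R]_n * 'rV['cV[R]_d]_n) : 'cV[R]_d := \sum_i wv.1 0 i *: wv.2 0 i.
have -> : convex_combinations A n = f @` (D `*` An).
  apply/seteqP; split=> [x [p [w [Ap w0 w1 ->]]]|x [[w v] [[/= wI w1] vA] <-]].
    exists (\row_i w i, \row_i p i).
      split; [split|] => //=.
      - move=> i; rewrite mxE/= in_itv/= w0/= -w1 (bigD1 i)//= lerDl.
        exact: sumr_ge0.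
      - by under eq_bigr do rewrite mxE.
      - by move=> i; rewrite mxE.
    by rewrite /f; apply: eq_bigr => i _; rewrite !mxE.
  exists (v 0), (w 0); split => // i.
  by have := wI i; rewrite /= in_itv/= => /andP[].
apply: continuous_compact; last exact: compact_setX.
have wcont i : continuous (fun wv : 'rV[R]_n * 'rV['cV[R]_d]_n => wv.1 0 i).
  move=> wv; apply: (@continuous_comp _ _ _ fst (fun w : 'rV[R]_n => w 0 i)).
    exact: cvg_fst.
  exact: coord_continuous.
have vcont i : continuous (fun wv : 'rV[R]_n * 'rV['cV[R]_d]_n => wv.2 0 i).
  move=> wv.
  apply: (@continuous_comp _ _ _ snd (fun v : 'rV['cV[R]_d]_n => v 0 i)).
    exact: cvg_snd.
  exact: ptmx_coord_continuous.
apply: continuous_subspaceT; apply: continuous_sum => i wv.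
by apply: cvgZ; [exact: wcont|exact: vcont].
Qed.

Lemma convex_hull_compact (R : realType) (d : nat) (A : set 'cV[R]_d) :
  compact A -> compact (convex_hull A).
Proof. by rewrite caratheodory; exact: convex_combinations_compact. Qed.

(** * Convexity and topology in normed spaces *)

Section ConvexTopology.
Variables (R : realType) (V : normedModType R).
Implicit Types A : set V.

(** A convex set is the union of the segments from one of its points. *)
Lemma connected_convex A : convex_set (A : set (convex_lmodType V)) -> connected A.
Proof.
move=> /convex_setP cA.
have [->|/set0P[x Ax]] := eqVneq A set0; first exact: connected0.
have -> : A = \bigcup_(y in A) ((fun t : R => t *: x + (1 - t) *: y) @` `[0, 1]%classic).
  apply/seteqP; split=> [y Ay|z [y Ay [t /=]]].
    exists y => //; exists 0; first by rewrite /= in_itv/= lexx ler01.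
    by rewrite scale0r subr0 scale1r add0r.
  by rewrite in_itv/= => /andP[t0 t1] <-; exact: cA.
apply: bigcup_connected.
  exists x => y Ay; exists 1; first by rewrite /= in_itv/= lexx ler01.
  by rewrite scale1r subrr scale0r addr0.
move=> y Ay; apply: connected_continuous_connected.
  exact: segment_connected.
apply: continuous_subspaceT => t; apply: cvgD; first exact: cvgZr_tmp.
by apply: cvgZr_tmp; apply: cvgB => //; exact: cvg_cst.
Qed.

Lemma ball_convex (x : V) (r : R) :
  convex_set (ball x r : set (convex_lmodType V)).
Proof.
apply/convex_setP => y z t t0 t1; rewrite -ball_normE /= => xy xz.
have -> : x - (t *: y + (1 - t) *: z) = t *: (x - y) + (1 - t) *: (x - z).
  by rewrite !scalerBr addrACA -scalerDl [t + _]addrC subrK scale1r opprD.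
rewrite (le_lt_trans (ler_normD _ _))// !normrZ ger0_norm// ger0_norm ?subr_ge0//.
have [->|tn0] := eqVneq t 0; first by rewrite mul0r add0r subr0 mul1r.
have -> : r = t * r + (1 - t) * r by rewrite -mulrDl [t + _]addrC subrK mul1r.
apply: ltr_leD; first by rewrite ltr_pM2l// lt_neqAle eq_sym tn0.
by rewrite ler_wpM2l ?subr_ge0// ltW.
Qed.

(** Around a point of a component, a ball contained in [A] is connected, hence it
    stays in the component. *)
Lemma open_connected_component A x : open A -> open (connected_component A x).
Proof.
move=> oA; rewrite openE => y Axy.
have /nbhs_ballP[r /= r0 yrA] : nbhs y A.
  by apply: open_nbhs_nbhs; split => //; exact: connected_component_sub Axy.
apply/nbhs_ballP; exists r => //= z yrz.
rewrite (same_connected_component Axy).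
have yy : ball y r y by exact: ballxx.
apply: (connected_component_max yy yrA _ yrz).
by apply: connected_convex; exact: ball_convex.
Qed.

(** A point of [A] is approached along the segment that joins it to an interior
    point, and that segment consists of interior points. *)
Lemma convex_closure_interior A :
  convex_set (A : set (convex_lmodType V)) -> A° !=set0 -> A `<=` closure A°.
Proof.
move=> /convex_setP cA [z]; rewrite /interior => /nbhs_ballP[r /= r0 zrA] x Ax.
(* Shrinking towards x by the factor t sends the ball of radius r around the
   interior point z to the ball of radius t * r around t z + (1 - t) x. *)
have intA t : 0 < t -> t <= 1 -> A° (t *: z + (1 - t) *: x).
  move=> t0 t1; apply/nbhs_ballP; exists (t * r) => /=; first exact: mulr_gt0.
  move=> y; rewrite -ball_normE /= => yt.
  have -> : y = t *: (z + t^-1 *: (y - (t *: z + (1 - t) *: x))) + (1 - t) *: x.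
    rewrite scalerDr scalerA divff ?gt_eqF// scale1r.
    by rewrite [_ + (y - _)]addrC -addrA subrK.
  apply: cA => //; first exact: ltW.
  apply: zrA; rewrite -ball_normE /= opprD addNKr normrN normrZ.
  by rewrite gtr0_norm ?invr_gt0// ltr_pdivrMl// distrC.
move=> B /nbhs_ballP[e /= e0 xeB].
(* The point of parameter t is at distance t * |x - z| from x, which this choice
   makes smaller than e; adding 1 keeps the denominator positive if x = z. *)
pose t := Num.min 1 (e / (2 * (`|x - z| + 1))).
have n0 : 0 < `|x - z| + 1 by rewrite ltr_wpDl.
have t0 : 0 < t by rewrite lt_min ltr01/= divr_gt0// mulr_gt0.
have t1 : t <= 1 by rewrite ge_min lexx.
exists (t *: z + (1 - t) *: x); split; first exact: intA.
apply: xeB; rewrite -ball_normE /=.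
have -> : x - (t *: z + (1 - t) *: x) = t *: (x - z).
  by rewrite scalerBl scale1r scalerBr opprD opprB addrCA [x + _]addrC subrK addrC.
rewrite normrZ gtr0_norm//.
have : t * (2 * (`|x - z| + 1)) <= e.
  by rewrite -ler_pdivlMr ?mulr_gt0// ge_min lexx orbT.
move=> h; apply: lt_le_trans h; rewrite ltr_pM2l//.
by rewrite mulr_natl mulr2n -addrA ltr_pwDr// ltr_wpDl// addr_gt0.
Qed.

End ConvexTopology.

(** * Invertible affine maps *)

Lemma image_closure (T U : topologicalType) (h : T -> U) (B : set T) :
  continuous h -> h @` closure B `<=` closure (h @` B).
Proof.
move=> ch _ [x Bx <-] N /ch /Bx [y [By Ny]].
by exists (h y); split => //; exists y.
Qed.

Section AffineMaps.
Variables (R : realType) (d : nat).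
Implicit Types (f : 'cV[R]_d -> 'cV[R]_d) (A : set 'cV[R]_d).

Lemma mulmx_continuous (M : 'M[R]_d) : continuous (fun x : 'cV[R]_d => M *m x).
Proof.
have -> : (fun x : 'cV[R]_d => M *m x) = fun x => \sum_j x j 0 *: col j M.
  apply/funext => x; apply/colP => i; rewrite mxE summxE.
  by apply: eq_bigr => j _; rewrite !mxE mulrC.
apply: continuous_sum => j x.
exact: (cvgZr_tmp (@coord_continuous R d 1 j 0 x)).
Qed.

Lemma invertible_affine_continuous f : invertible_affine f -> continuous f.
Proof.
move=> [M [b [_ fE]]]; have -> : f = fun x => M *m x + b by exact/funext.
by move=> x; exact: (cvgD (@mulmx_continuous M x) (cvg_cst _)).
Qed.

Lemma invertible_affine_inverse f : invertible_affine f ->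
  exists g, [/\ invertible_affine g, cancel f g & cancel g f].
Proof.
move=> [M [b [uM fE]]]; exists (fun x => invmx M *m (x - b)); split.
- exists (invmx M), (- (invmx M *m b)); split; first by rewrite unitmx_inv.
  by move=> x; rewrite mulmxBr.
- by move=> x; rewrite fE addrK mulKmx.
- by move=> x; rewrite fE mulKVmx// subrK.
Qed.

Lemma invertible_affine_inj f : invertible_affine f -> injective f.
Proof. by move=> /invertible_affine_inverse[g [_ /can_inj]]. Qed.

Lemma invertible_affine_id : invertible_affine (@id 'cV[R]_d).
Proof.
by exists 1%:M, 0; split => [|x]; rewrite ?unitmx1// mul1mx addr0.
Qed.

Lemma invertible_affine_comp f g :
  invertible_affine f -> invertible_affine g -> invertible_affine (f \o g).
Proof.
move=> [M [b [uM fE]]] [N [c [uN gE]]]; exists (M *m N), (M *m c + b).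
split=> [|x]; first by rewrite unitmx_mul uM.
by rewrite /= gE fE mulmxDr mulmxA addrA.
Qed.

Lemma affine_image_convex f A : invertible_affine f ->
  convex_set (A : set (convex_lmodType 'cV[R]_d)) ->
  convex_set (f @` A : set (convex_lmodType 'cV[R]_d)).
Proof.
move=> [M [b [_ fE]]] /convex_setP cA; apply/convex_setP.
move=> _ _ t t0 t1 [x Ax <-] [y Ay <-].
exists (t *: x + (1 - t) *: y); first exact: cA.
rewrite !fE !scalerDr addrACA -scalerDl [t + _]addrC subrK scale1r.
by rewrite mulmxDr !scalemxAr.
Qed.

Lemma affine_preimage_convex f A : invertible_affine f ->
  convex_set (A : set (convex_lmodType 'cV[R]_d)) ->
  convex_set (f @^-1` A : set (convex_lmodType 'cV[R]_d)).
Proof.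
move=> [M [b [_ fE]]] /convex_setP cA; apply/convex_setP.
move=> x y t t0 t1 /= Ax Ay.
suff -> : f (t *: x + (1 - t) *: y) = t *: f x + (1 - t) *: f y by exact: cA.
rewrite !fE !scalerDr addrACA -scalerDl [t + _]addrC subrK scale1r.
by rewrite mulmxDr !scalemxAr.
Qed.

Lemma affine_image_open f A : invertible_affine f -> open A -> open (f @` A).
Proof.
move=> /invertible_affine_inverse[g [ag fK gK]] oA.
have -> : f @` A = g @^-1` A.
  apply/seteqP; split=> [_ [x Ax <-]|x Agx]; first by rewrite /= fK.
  by exists (g x).
by apply: open_comp => // x _; exact: invertible_affine_continuous.
Qed.

End AffineMaps.

(** * Euclidean norm and sup norm *)

Section EuclideanNorm.
Variables (R : realType) (d : nat).
Implicit Types x : 'cV[R]_d.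

Lemma coord_le_norm x i : `|x i 0| <= `|x|.
Proof.
rewrite [leRHS]/Num.norm/= mx_normrE; apply/bigmax_geP; right => /=.
by exists (i, 0).
Qed.

Lemma norm_le_enorm x : `|x| <= enorm x.
Proof.
rewrite [leLHS]/Num.norm/= mx_normrE; apply/bigmax_leP => /=.
split=> [|[i j] _]; first exact: sqrtr_ge0.
rewrite /= (ord1 j) -sqrtr_sqr ler_wsqrtr// (bigD1 i)//= lerDl.
by apply: sumr_ge0 => k _; exact: sqr_ge0.
Qed.

Lemma enorm_le_norm x : enorm x <= Num.sqrt d%:R * `|x|.
Proof.
rewrite -[X in _ * X]ger0_norm// -sqrtr_sqr -sqrtrM// ler_wsqrtr//.
rewrite mulrC -[X in X * _]/(`|x| ^+ 2) mulr_natr.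
rewrite -[X in _ *+ X]card_ord -sumr_const; apply: ler_sum => i _.
by rewrite -[leLHS]real_normK ?num_real// lerXn2r ?nnegrE// coord_le_norm.
Qed.

End EuclideanNorm.

(** * Countability of the tiles *)

Section Countability.

Lemma rational_points_dense (R : realType) (d : nat) :
  dense (range (map_mx (ratr : rat -> R) : 'cV[rat]_d -> 'cV[R]_d)).
Proof.
move=> U [x Ux] oU.
have /nbhs_ballP[e /= e0 xeU] : nbhs x U by exact: open_nbhs_nbhs.
have q i : exists q : rat, ball (x i 0) e (ratr q).
  have [y [xr [q _ qy]]] : ball (x i 0) e `&` range (@ratr R) !=set0.
    apply: dense_rat; last exact: ball_open.
    by exists (x i 0); exact: ballxx.
  by exists q; rewrite qy.
exists (map_mx ratr (\col_i sval (cid (q i)))); split; last first.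
  by exists (\col_i sval (cid (q i))).
apply: xeU; split => // i j; rewrite !mxE (ord1 j).
exact: (svalP (cid (q i))).
Qed.

(** Each set is sent to a rational point that it contains. *)
Lemma disjoint_open_countable (R : realType) (d : nat) (D : set (set 'cV[R]_d)) :
  (forall G, D G -> open G) -> (forall G, D G -> G !=set0) ->
  trivIset D id -> countable D.
Proof.
move=> oD D0 tD.
have q G : exists q : 'cV[rat]_d, D G -> G (map_mx ratr q).
  have [DG|nDG] := pselect (D G); last by exists 0.
  have [y [Gy [q _ qy]]] := rational_points_dense (D0 _ DG) (oD _ DG).
  by exists q; rewrite qy.
apply: (@sub_countable _ _ _ [set: 'cV[rat]_d]); last exact: countableP.
apply/pcard_injP; exists (fun G => sval (cid (q G))).
move=> G H /[!inE] DG DH GH; apply: tD => //.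
exists (map_mx ratr (sval (cid (q G)))); split.
  exact: (svalP (cid (q G))).
by rewrite GH; exact: (svalP (cid (q H))).
Qed.

Lemma enumerate_countable (T : Type) (A : set T) :
  countable A -> infinite_set A -> exists e : nat -> T, set_bij [set: nat] A e.
Proof.
elim/Ppointed: T => T in A *.
  by move=> _ []; rewrite (empty_eq0 A); exact: finite_set0.
by move=> cA iA; apply/card_set_bijP/card_esym/eq_card_nat.
Qed.

Lemma infinite_words (T : Type) (x : T) : infinite_set [set: seq T].
Proof.
move=> /(finite_image size) fw; apply: infinite_nat; apply: sub_finite_set fw.
by move=> n _; exists (nseq n x) => //; exact: size_nseq.
Qed.

End Countability.

(** * The tiling *)

Section SelfAffineTiling.
Variables (R : realType) (d J : nat).
Variables (Phi : 'I_J -> 'cV[R]_d -> 'cV[R]_d) (F C : set 'cV[R]_d).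
Hypothesis hPhi : self_affine_system Phi.
Hypothesis hF : is_attractor Phi F.
Hypothesis hC : C = convex_hull F.
Hypothesis htile : tileset_condition Phi C.
Hypothesis hnt : nontriviality_condition Phi C.

(** The generators are the components of this set. Nearly all of the argument is
    about the sets [Phi_w(U)]; they are cut into tiles only at the end. *)
Let U := (C `\` ifs_action Phi C)°.

Lemma self_affine_map j : invertible_affine (Phi j).
Proof. by have [_ /(_ j)[]] := hPhi. Qed.

Lemma word_map_affine w : invertible_affine (word_map Phi w).
Proof.
elim: w => [|j w IHw]; first exact: invertible_affine_id.
by apply: invertible_affine_comp => //; exact: self_affine_map.
Qed.

Lemma word_map_rcons w j : word_map Phi (rcons w j) = word_map Phi w \o Phi j.
Proof. by elim: w => //= l w ->. Qed.

Lemma word_map_contraction : exists2 c : R, 0 <= c < 1 &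
  forall w x y, enorm (word_map Phi w x - word_map Phi w y) <=
                c ^+ size w * enorm (x - y).
Proof.
have /choice[c cP] : forall j, euclidean_contraction (Phi j).
  by move=> j; case: hPhi => _ /(_ j)[].
pose m := \big[Num.max/0]_j c j.
have m0 : 0 <= m by exact: bigmax_ge_id.
exists m; first by rewrite m0/=; apply: bigmax_lt => // j _; have [] := cP j.
elim=> [x y|j w IHw x y]; first by rewrite expr0 mul1r.
have [c0 _ cle] := cP j.
rewrite /= (le_trans (cle _ _))// exprS -mulrA.
apply: (@le_trans _ _ (c j * (m ^+ size w * enorm (x - y)))).
  by rewrite ler_wpM2l.
by rewrite ler_wpM2r ?mulr_ge0 ?exprn_ge0 ?sqrtr_ge0//; exact: le_bigmax.
Qed.

Lemma attractor_sub_hull : F `<=` C.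
Proof. by rewrite hC; exact: sub_gen_smallest. Qed.

Lemma hull_convex : convex_set (C : set (convex_lmodType 'cV[R]_d)).
Proof. by rewrite hC; exact: convex_hull_convex. Qed.

Lemma hull_compact : compact C.
Proof. by rewrite hC; apply: convex_hull_compact; case: hF. Qed.

Lemma hull_closed : closed C.
Proof. by apply: compact_closed; [exact: norm_hausdorff|exact: hull_compact]. Qed.

(** The preimage of [C] under [Phi j] is convex and contains [F]. *)
Lemma hull_image_sub j : Phi j @` C `<=` C.
Proof.
suff : C `<=` Phi j @^-1` C by move=> CC _ [x /CC Cx <-].
rewrite {1}hC; apply: smallest_sub.
  exact: affine_preimage_convex (self_affine_map j) hull_convex.
move=> x Fx /=; apply: attractor_sub_hull.
by have [_ _ ->] := hF; exists j => //; exists x.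
Qed.

Lemma ifs_hull_closed : closed (ifs_action Phi C).
Proof.
apply: closed_bigcup => [|j _]; first exact: finite_finset.
apply: compact_closed; first exact: norm_hausdorff.
apply: continuous_compact; last exact: hull_compact.
exact/continuous_subspaceT/invertible_affine_continuous/self_affine_map.
Qed.

Lemma gap_setE : U = C° `\` ifs_action Phi C.
Proof.
rewrite /U setDE interiorI interiorC -(closure_id _).1//.
exact: ifs_hull_closed.
Qed.

Lemma gap_set_nonempty : U !=set0.
Proof.
apply/set0P/eqP => U0; apply: hnt => x Cx; apply: contrapT => nx.
suff : U x by rewrite U0.
by rewrite gap_setE.
Qed.

Lemma hull_interior_nonempty : C° !=set0.
Proof. by have [x] := gap_set_nonempty; rewrite gap_setE => -[Cx _]; exists x. Qed.

Lemma gap_set_sub : U `<=` C.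
Proof. by move=> x /interior_subset[]. Qed.

Lemma gap_set_disjoint x j : U x -> ~ (Phi j @` C) x.
Proof. by move=> /interior_subset[_ nx] jx; apply: nx; exists j. Qed.

(** The point is a limit of interior points of [C], and near it none of them lies
    in the closed set [Phi(C)]. *)
Lemma hull_minus_ifs_sub_closure : C `\` ifs_action Phi C `<=` closure U.
Proof.
move=> x [Cx nx] B xB.
have nbx : nbhs x (B `&` ~` ifs_action Phi C).
  apply: filterI => //; apply: open_nbhs_nbhs; split => //.
  exact/closed_openC/ifs_hull_closed.
have [y [Cy [By ny]]] :=
  convex_closure_interior hull_convex hull_interior_nonempty Cx nbx.
by exists y; split => //; rewrite gap_setE.
Qed.

Lemma word_image_hull_sub w : word_map Phi w @` C `<=` C.
Proof.
elim: w => [|j w IHw] _ [x Cx <-] //=; apply: (@hull_image_sub j).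
by exists (word_map Phi w x) => //; apply: IHw; exists x.
Qed.

Lemma word_image_gap_sub w : word_map Phi w @` U `<=` C.
Proof.
move=> _ [x Ux <-]; apply: (@word_image_hull_sub w).
by exists x => //; exact: gap_set_sub.
Qed.

Lemma word_image_gap_open w : open (word_map Phi w @` U).
Proof. by apply: affine_image_open; [exact: word_map_affine|exact: open_interior]. Qed.

Lemma word_image_gap_interior j w :
  word_map Phi (j :: w) @` U `<=` (Phi j @` C)°.
Proof.
rewrite -open_subsetE; last exact: word_image_gap_open.
move=> _ [x Ux <-] /=; exists (word_map Phi w x) => //.
by apply: (@word_image_gap_sub w); exists x.
Qed.

(** The tileset condition separates two interiors; here one of them is enlarged
    to the whole image, which is contained in the closure of its interior. This
    form is needed for [F], which has no reason to meet any interior. *)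
Lemma interior_disjoint_image x j l : j <> l -> (Phi j @` C)° x -> ~ (Phi l @` C) x.
Proof.
move=> jl jx lx.
have cl : convex_set (Phi l @` C : set (convex_lmodType 'cV[R]_d)).
  exact: affine_image_convex (self_affine_map l) hull_convex.
have il : (Phi l @` C)° !=set0.
  have oC : open (Phi l @` C°).
    exact: affine_image_open (self_affine_map l) (@open_interior _ _).
  have : Phi l @` C° `<=` Phi l @` C by exact: image_subset (@interior_subset _ _).
  rewrite open_subsetE// => sub.
  have [y Cy] := hull_interior_nonempty.
  by exists (Phi l y); apply: sub; exists y.
have [y [ly jy]] := convex_closure_interior cl il lx (nbhs_interior jx).
by have := htile jl; apply/eqP/set0P; exists y.
Qed.

(** Common first letters are removed by injectivity. Distinct first letters are
    excluded by the tileset condition, and an exhausted word by the fact that [U]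
    avoids [Phi(C)]. *)
Lemma word_image_gap_inj w v x :
  (word_map Phi w @` U) x -> (word_map Phi v @` U) x -> w = v.
Proof.
elim: w v x => [|j w IHw] [|l v] x // wx vx.
- case: wx => y Uy yx; rewrite /= in yx; subst y.
  by case: (gap_set_disjoint Uy (interior_subset (word_image_gap_interior vx))).
- case: vx => y Uy yx; rewrite /= in yx; subst y.
  by case: (gap_set_disjoint Uy (interior_subset (word_image_gap_interior wx))).
- have [jl|jl] := eqVneq j l; last first.
    have := interior_subset (word_image_gap_interior vx).
    by case/(interior_disjoint_image (elimN eqP jl) (word_image_gap_interior wx)).
  subst l; case: wx => y Uy yx; case: vx => z Uz zx; congr cons.
  apply: (IHw _ (word_map Phi w y)); first by exists y.
  exists z => //; apply: (invertible_affine_inj (self_affine_map j)).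
  by move: yx zx => /= -> ->.
Qed.

(** A point of [F] lies in [Phi_l(F)] for some [l]. If [l] is the first letter of
    the word, it can be removed, since the preimage of the point is again in [F];
    otherwise the images of [C] under [Phi_j] and [Phi_l] conflict. *)
Lemma word_image_gap_attractor w x : (word_map Phi w @` U) x -> ~ F x.
Proof.
elim: w x => [|j w IHw] x wx; have [_ _ ->] := hF => -[l _ [y Fy yx]].
  case: wx => z Uz zx; rewrite /= in zx; subst z.
  by apply: (@gap_set_disjoint _ l Uz); exists y => //; exact: attractor_sub_hull.
have [jl|jl] := eqVneq j l; last first.
  apply: (interior_disjoint_image (elimN eqP jl) (word_image_gap_interior wx)).
  by exists y => //; exact: attractor_sub_hull.
subst l; case: wx => z Uz zx; apply: (IHw y) => //; exists z => //.
by apply: (invertible_affine_inj (self_affine_map j)); rewrite yx -zx.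
Qed.

Let T := \bigcup_(w in [set: seq 'I_J]) (word_map Phi w @` U).

(** Either the point of [C] that [Phi_w] sends to [x] is again in [Phi(C)], which
    lengthens [w] by a letter on the right, or it is a limit of points of [U]. *)
Lemma hull_cover k x : C x ->
  closure T x \/ exists2 w, size w = k & (word_map Phi w @` C) x.
Proof.
move=> Cx; elim: k => [|k [IH|[w wk [y Cy yx]]]].
- by right; exists [::] => //; exists x.
- by left.
have [[j _ [z Cz zy]]|ny] := pselect (ifs_action Phi C y).
  right; exists (rcons w j); first by rewrite size_rcons wk.
  by exists z => //; rewrite word_map_rcons /= zy.
left; apply: (@closureS _ (word_map Phi w @` U)).
  by move=> z wz; exists w.
apply: image_closure; first exact/invertible_affine_continuous/word_map_affine.
by exists y => //; exact: hull_minus_ifs_sub_closure.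
Qed.

(** If [x] is not a limit of points of [T], it lies in [Phi_w(C)] for arbitrarily
    long [w]. The diameter of this set is at most [D * c ^+ size w] and it
    contains [Phi_w(u0)], a point of [T] for any [u0] in [U]. *)
Lemma hull_closure_word_images : C = closure T.
Proof.
apply/seteqP; split; last first.
  rewrite [X in _ `<=` X](closure_id _).1; last exact: hull_closed.
  by apply: closureS => x [w _]; exact: word_image_gap_sub.
move=> x Cx; apply: contrapT => nTx.
have wC k : exists2 w, size w = k & (word_map Phi w @` C) x.
  by have [] := hull_cover k Cx.
apply: nTx => B /nbhs_ballP[e /= e0 xeB].
have [u0 Uu0] := gap_set_nonempty.
have [c /andP[c0 c1] cP] := word_map_contraction.
have /compact_bounded[M [_ /(_ (M + 1))]] := hull_compact.
rewrite ltrDl ltr01 => /(_ isT) CM.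
pose D := Num.sqrt d%:R * ((M + 1) + (M + 1)).
have DP y z : C y -> C z -> enorm (y - z) <= D.
  move=> Cy Cz; rewrite (le_trans (enorm_le_norm _))// ler_wpM2l ?sqrtr_ge0//.
  by rewrite (le_trans (ler_normB _ _))// lerD//; exact: CM.
have [k ck] : exists k, D * c ^+ k < e.
  have : geometric D c n @[n --> \oo] --> (0 : R).
    by apply: cvg_geometric; rewrite ger0_norm.
  move=> /cvgrPdist_lt/(_ e e0)[n _ /(_ n (leqnn _))].
  rewrite /= sub0r normrN => h; exists n.
  exact: le_lt_trans (ler_norm _) h.
have [w wk [y Cy yx]] := wC k.
exists (word_map Phi w u0); split; first by exists w => //; exists u0.
apply: xeB; rewrite -ball_normE /= -yx.
apply: le_lt_trans (norm_le_enorm _) _; apply: le_lt_trans (cP _ _ _) _.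
apply: le_lt_trans ck; rewrite wk mulrC ler_wpM2r ?exprn_ge0//.
by apply: DP => //; exact: gap_set_sub.
Qed.

Lemma generator_sub G : generators Phi C G -> G `<=` U.
Proof. by move=> [x Ux <-]; exact: connected_component_sub. Qed.

Lemma generator_open G : generators Phi C G -> open G.
Proof. by move=> [x Ux <-]; exact/open_connected_component/open_interior. Qed.

Lemma generator_connected G : generators Phi C G -> connected G.
Proof. by move=> [x Ux <-]; exact: component_connected. Qed.

Lemma generator_nonempty G : generators Phi C G -> G !=set0.
Proof. by move=> [x Ux <-]; exists x; exact: connected_component_refl. Qed.

Lemma generators_disjoint : trivIset (generators Phi C) id.
Proof.
move=> G H [x Ux <-] [y Uy <-] [z [/= xz yz]].
by rewrite (same_connected_component xz) (same_connected_component yz).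
Qed.

Lemma bigcup_generators w :
  \bigcup_(G in generators Phi C) (word_map Phi w @` G) = word_map Phi w @` U.
Proof. by rewrite -image_bigcup; congr (_ @` _); exact: connected_component_cover. Qed.

Lemma tile_enumeration_exists : exists e, tile_enumeration Phi C e.
Proof.
apply: enumerate_countable.
  apply: countableX; first exact: countableP.
  apply: disjoint_open_countable generators_disjoint.
    exact: generator_open.
  exact: generator_nonempty.
have [x Ux] := gap_set_nonempty.
have J0 : (0 < J)%N by case: hPhi => /ltnW.
move=> /(finite_image fst) fw; apply: (infinite_words (Ordinal J0)).
apply: sub_finite_set fw => w _.
by exists (w, connected_component U x) => //; split => //; exists x.
Qed.

Lemma bigcup_tiles e : tile_enumeration Phi C e ->
  \bigcup_n tile Phi (e n) = \bigcup_(w in [set: seq 'I_J])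
                   \bigcup_(G in generators Phi C) (word_map Phi w @` G).
Proof.
move=> [efun einj esurj]; apply/seteqP; split=> [x [n _ ex]|x [w _ [G gG wx]]].
  have [_ gG] := efun n I.
  by exists (e n).1 => //; exists (e n).2.
by have [//|n _ en] := esurj (w, G); exists n => //; rewrite /tile en.
Qed.

Lemma tiles_disjoint p q : generators Phi C p.2 -> generators Phi C q.2 ->
  tile Phi p `&` tile Phi q !=set0 -> p = q.
Proof.
case: p q => [w G] [v H] /= gG gH [x [[y Gy yx] [z Hz zx]]].
have wv : w = v.
  apply: (@word_image_gap_inj w v x).
    by exists y => //; exact: (generator_sub gG).
  by exists z => //; exact: (generator_sub gH).
subst v; congr pair; apply: generators_disjoint => //; exists y; split => //=.
suff -> : y = z by [].
by apply: (invertible_affine_inj (word_map_affine w)); rewrite yx -zx.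
Qed.

End SelfAffineTiling.

Theorem theorem5p16 (R : realType) (d J : nat)
    (Phi : 'I_J -> 'cV[R]_d -> 'cV[R]_d) (F C : set 'cV[R]_d)
    (hPhi : self_affine_system Phi)
    (hF : is_attractor Phi F)
    (hC : C = convex_hull F)
    (hdim : affine_hull C = [set: 'cV[R]_d])
    (htile : tileset_condition Phi C)
    (hnt : nontriviality_condition Phi C) :
  (exists e, tile_enumeration Phi C e) /\
  forall e, tile_enumeration Phi C e ->
    [/\ open_tiling (C `\` F) (fun n => tile Phi (e n)),
        C = closure (\bigcup_n tile Phi (e n)) &
        closure (\bigcup_n tile Phi (e n)) =
        closure (\bigcup_(w in [set: seq 'I_J])
                   \bigcup_(G in generators Phi C) (word_map Phi w @` G))].
Proof.
split=> [|e he]; first exact: tile_enumeration_exists hF hC hnt.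
have eU := bigcup_tiles he.
have gG n : generators Phi C (e n).2 by have [/(_ n I)[]] := he.
have CE : C = closure (\bigcup_n tile Phi (e n)).
  rewrite eU; under eq_bigcupr do rewrite bigcup_generators.
  exact: hull_closure_word_images hF hC hnt.
have TF : \bigcup_n tile Phi (e n) `<=` C `\` F.
  rewrite eU => x [w _]; rewrite bigcup_generators => wx; split.
    exact: (word_image_gap_sub hPhi hF hC wx).
  exact: (word_image_gap_attractor hPhi hF hC htile hnt wx).
split=> //; last by rewrite eU.
split=> [n||n m nm].
- have wA := word_map_affine hPhi (e n).1; split.
  + have [x Gx] := generator_nonempty (gG n).
    by exists (word_map Phi (e n).1 x); exists x.
  + apply: connected_continuous_connected; first exact: generator_connected.
    exact/continuous_subspaceT/invertible_affine_continuous.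
  + by apply: affine_image_open => //; exact: generator_open.
- apply/seteqP; split; last exact: closureS.
  rewrite -CE [X in _ `<=` X](closure_id _).1; last exact: hull_closed hF hC.
  by apply: closureS => x [].
- apply/eqP; apply: contrapT => /negP/set0P nm0; apply: nm.
  have [_ einj _] := he; apply: einj; rewrite ?inE//.
  exact: (tiles_disjoint hPhi hF hC htile hnt _ _ nm0).
Qed.
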